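(* Let $C_m$ be a Hermitian code with $m\ge q^2-q-1$ and $m=\widetilde m$. Let $x^uy^v\in\mathcal{B}$ be a monomial with $w(x^uy^v)=m+1+\kappa$ for some integer $0\le\kappa\le q$. If $D$ is a divisor over $\mathcal{H}$ such that $x^uy^v\in\mathcal{N}(\mathrm{In}_\prec(I_D))$, then $$|D|\ge \widetilde\delta_m+\kappa .$$ More precisely, if $\delta(m)=\mu q+\lambda(q+1)$ (with $0\le \mu\le q$, $\lambda\ge 0$), then: (a) if $\mu=0$ and $0\le\kappa\le q-\lambda$, then $|D|\ge\widetilde\delta_m+\kappa(q+1-\lambda-\kappa)$; (b) if $\mu=0$ and $\kappa\ge q-\lambda+1$, then $|D|\ge\widetilde\delta_m+\kappa$; (c) if $\mu\ne0$ and $0\le\kappa\le\mu-1$, then $|D|\ge\widetilde\delta_m+\kappa$; (d) if $\mu\neq0$ and $\mu\le\kappa\le q-\lambda$, then $|D|\ge\widetilde\delta_m+(\kappa-\mu)(q-\lambda-\kappa)+\kappa$; (e) if $\mu\ne0$ and $q-\lambda+1\le\kappa\le q$, then $|D|\ge\widetilde\delta_m+\kappa$.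
   Context: $q$ is a power of a prime, $A=\mathbb{F}_{q^2}[x,y]$, and $\mathcal{H}$ is the affine Hermitian curve defined by $H=x^{q+1}-y^q-y$. It has exactly $n=q^3$ points $P_1,\dots,P_n$ with coordinates in $\mathbb{F}_{q^2}$; $E=\{P_1,\dots,P_n\}$ and $A_E=A/\langle H,x^{q^2}-x,y^{q^2}-y\rangle$. Weights: $w(x^ry^s)=rq+s(q+1)$. $V_m\subseteq A_E$ is the span of the classes of monomials of weight $w\le m$, and the Hermitian code $C_m\subseteq(\mathbb{F}_{q^2})^n$ is the dual code of $\{(f(P_1),\dots,f(P_n)) : f\in V_m\}$, where $0\le m\le q^3+q^2-q-2$. $\mathcal{B}=\{x^ry^s : 0\le r\le q,\ 0\le s\le q^2-q-1\}\cup\{y^s : q^2-q\le s\le q^2-1\}$, and $\Lambda_{\mathcal{B}}=\{w(x^ry^s): x^ry^s\in\mathcal{B}\}$. Codes are always labelled by integers $m$ with $m+1\in\Lambda_{\mathcal{B}}$. $\Lambda$ is the numerical semigroup generated by $q$ and $q+1$; each element is written uniquely as $aq+b(q+1)$ with integers $0\le a\le q$, $b\ge0$. Put $\delta(m)=m-q^2+q+2=m-(q-2)(q+1)$. $\widetilde m$ denotes the minimum integer $m'\ge m$ such that both $m'+1\in\Lambda_{\mathcal{B}}$ and $\delta(m')\in\Lambda$; and $\widetilde\delta_m=\delta(\widetilde m)$. $\prec$ is the degree reverse lexicographic order with $y>x$: $x^{r_1}y^{r_2}\prec x^{s_1}y^{s_2}$ iff $r_1+r_2<s_1+s_2$, or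 $r_1+r_2=s_1+s_2$ and $r_1>s_1$. For an ideal $I\subseteq A$, $\mathrm{In}_\prec(I)$ is the ideal generated by the $\prec$-leading monomials of elements of $I$, and $\mathcal{N}(\mathrm{In}_\prec(I))$ is the set of monomials not in $\mathrm{In}_\prec(I)$. A divisor $D$ over $\mathcal{H}$ is an effective divisor on the affine curve $\mathcal{H}$ defined over $\mathbb{F}_{q^2}$, i.e. a zero-dimensional subscheme given by an ideal $I_D\subseteq A$ with $H\in I_D$ and $A/I_D$ of finite dimension; its degree is $|D|=\dim_{\mathbb{F}_{q^2}}A/I_D$. In particular every subset $D\subseteq E$ is such a divisor, with $I_D$ the ideal of polynomials vanishing on $D$ and $|D|$ its cardinality. *)

(* Defs.v *)
From HB Require Import structures.
From mathcomp Require Import all_boot all_order all_algebra.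
From mathcomp Require Import mpoly.

Set Implicit Arguments.
Unset Strict Implicit.
Unset Printing Implicit Defensive.

Import Order.TTheory GRing.Theory Num.Theory.
Local Open Scope ring_scope.

(* In {mpoly F[2]}, the variable of index 0 is x and that of index 1 is y. *)
Definition ix : 'I_2 := @Ordinal 2 0 isT.
Definition iy : 'I_2 := @Ordinal 2 1 isT.

Definition xymon (u v : nat) : 'X_{1..2} := (U_(ix) *+ u + U_(iy) *+ v)%MM.

Definition weight (q : nat) (M : 'X_{1..2}) : nat := (M ix * q + M iy * q.+1)%N.

(* Degree reverse lexicographic order with y > x. *)
Definition drl_lt (M N : 'X_{1..2}) : bool :=
  ((M ix + M iy < N ix + N iy)%N)
  || ((M ix + M iy == N ix + N iy)%N && (N ix < M ix)%N).

Definition inB (q : nat) (M : 'X_{1..2}) : bool :=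
  ((M ix <= q)%N && (M iy <= q ^ 2 - q - 1)%N)
  || [&& M ix == 0%N, (q ^ 2 - q <= M iy)%N & (M iy <= q ^ 2 - 1)%N].

Definition LambdaB (q n : nat) : Prop :=
  exists2 M : 'X_{1..2}, inB q M & n = weight q M.

(* Membership in the numerical semigroup generated by q and q + 1. *)
Definition Lambda (q : nat) (z : int) : Prop :=
  exists a b : nat, z = (a * q + b * q.+1)%N%:Z.

Definition delta (q m : nat) : int := m%:Z - (q ^ 2)%N%:Z + q%:Z + 2.

Definition tilde_cond (q m : nat) : Prop :=
  LambdaB q m.+1 /\ Lambda q (delta q m).

(* mt is the minimum of the integers m' >= m satisfying tilde_cond. *)
Definition is_tilde (q m mt : nat) : Prop :=
  [/\ (m <= mt)%N, tilde_cond q mt &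
      forall m' : nat, (m <= m')%N -> tilde_cond q m' -> (mt <= m')%N].

Section Hermitian.

Variable F : finFieldType.
Local Notation A := {mpoly F[2]}.

Definition hermitian_poly (q : nat) : A :=
  'X_ix ^+ q.+1 - 'X_iy ^+ q - 'X_iy.

Definition is_ideal (I : A -> Prop) : Prop :=
  [/\ I 0, forall f g, I f -> I g -> I (f + g) & forall a f, I f -> I (a * f)].

Definition ideal_gen (S : A -> Prop) : A -> Prop :=
  fun f => forall J : A -> Prop,
    is_ideal J -> (forall s, S s -> J s) -> J f.

(* For an ideal I: the F-vector space A / I has dimension d, the classes of
   the b i being a basis. *)
Definition quot_dim (I : A -> Prop) (d : nat) : Prop :=
  exists b : 'I_d -> A,
    forall f : A, exists! c : {ffun 'I_d -> F}, I (f - \sum_i c i *: b i).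

Definition is_lead_mon (f : A) (M : 'X_{1..2}) : Prop :=
  M \in msupp f /\ forall N, N \in msupp f -> N != M -> drl_lt N M.

Definition initial_ideal (I : A -> Prop) : A -> Prop :=
  ideal_gen (fun f => exists g M, [/\ I g, is_lead_mon g M & f = 'X_[M]]).

Definition footprint (I : A -> Prop) (M : 'X_{1..2}) : Prop :=
  ~ initial_ideal I 'X_[M].

(* The field div_deg is determined by div_ideal. *)
Record divisor (q : nat) := Divisor {
  div_ideal : A -> Prop;
  div_ideal_ideal : is_ideal div_ideal;
  div_ideal_H : div_ideal (hermitian_poly q);
  div_deg : nat;
  div_degP : quot_dim div_ideal div_deg
}.

Definition point_eval (P : F * F) (f : A) : F :=
  f.@[fun i => if i == ix then P.1 else P.2].

Definition hpoint (q : nat) : finType :=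
  {P : F * F | point_eval P (hermitian_poly q) == 0}.

(* Representatives in A of the elements of V_m. *)
Definition Vm (q m : nat) (f : A) : Prop :=
  forall M, M \in msupp f -> (weight q M <= m)%N.

(* C is the code C_m, m being an admissible label.  The coordinates of words
   are indexed by the rational points themselves; evaluation at these points
   depends only on the class of a polynomial in A_E. *)
Definition is_hermitian_code (q m : nat)
    (C : {vspace {ffun hpoint q -> F^o}}) : Prop :=
  [/\ (m <= q ^ 3 + q ^ 2 - q - 2)%N, LambdaB q m.+1 &
      forall c : {ffun hpoint q -> F^o},
        c \in C <->
        forall f, Vm q m f ->
          \sum_(P : hpoint q) (c P : F) * point_eval (val P) f = 0].

End Hermitian.

(* Main.v *)
Require Import Defs.
From HB Require Import structures.
From mathcomp Require Import all_boot all_order all_algebra.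
From mathcomp Require Import mpoly.
From mathcomp Require Import zify ring.

Set Implicit Arguments.
Unset Strict Implicit.
Unset Printing Implicit Defensive.

Import Order.TTheory GRing.Theory Num.Theory.
Local Open Scope ring_scope.

(** The weight [w] is the pole order at infinity, and on the monomials whose
    exponent of [x] is at most [q] it is injective and ordered as [drl_lt]
    orders them.  Modulo [H], every polynomial is congruent to a combination of
    such monomials of no larger weight, because [x^(q+1)] has the same weight
    as [y^q] and a larger one than [y].  Hence, for an ideal [I] containing
    [H], a polynomial of [I] with a single term of maximal weight
    [w(x^u y^v)] yields one whose [drl_lt]-leading monomial is [x^u y^v], as
    soon as that term reduces to [x^u y^v] (lemma [lead_initial_ideal]).

    Let [x^u y^v] be outside the initial ideal, and take the reduced monomials
    [M] for which some monomial [N] satisfies [w(M) + w(N) = w(x^u y^v)].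
    They are linearly independent modulo [I]: given a nontrivial relation,
    multiplying it by the [N] that matches its heaviest term [M] gives an
    element of [I] of the forbidden kind.  These [M] are the [(u+1)(v+1)]
    divisors of [x^u y^v], where [N] is the quotient, and the monomials
    [x^a y^b] with [u < a <= q] and [b + q <= v], which divide
    [x^(u+q+1) y^(v-q)], a monomial of the same weight.  So
    [|D| >= (u+1)(v+1) + (q-u) max(0, v+1-q)] (lemma
    [footprint_card_le_dim]).

    The rest is arithmetic.  With [s = w(x^u y^v)], this count is at least
    [s + 1 - q^2 + q = delta(m) + kappa], which is the general bound as well as
    (b), (c) and (e).  If [mu <= kappa], unique representation of [s] gives
    [u = q + mu - kappa] and [v = lambda + kappa - 1], and the product
    [(u+1)(v+1)] alone equals the bounds of (a) and (d). *)

(** * Monomials in two variables and their weights *)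

Lemma xymon_ix u v : xymon u v ix = u.
Proof. by rewrite /xymon mnmDE !mulmnE !mnm1E /= mul1n mul0n addn0. Qed.

Lemma xymon_iy u v : xymon u v iy = v.
Proof. by rewrite /xymon mnmDE !mulmnE !mnm1E /= mul1n mul0n add0n. Qed.

Lemma xymon_eta (M : 'X_{1..2}) : M = xymon (M ix) (M iy).
Proof.
apply/mnmP=> i; have [->|->] : i = ix \/ i = iy.
- by case: i => [[|[|//]] lti]; [left|right]; apply: val_inj.
- by rewrite xymon_ix.
- by rewrite xymon_iy.
Qed.

Lemma xymonD a b c d : (xymon a b + xymon c d)%MM = xymon (a + c) (b + d).
Proof.
by apply/mnmP=> i; rewrite /xymon !mnmDE !mulmnE; ring.
Qed.

Lemma weight_xymon q u v : weight q (xymon u v) = (u * q + v * q.+1)%N.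
Proof. by rewrite /weight xymon_ix xymon_iy. Qed.

Lemma weightD q (M N : 'X_{1..2}) : weight q (M + N)%MM = (weight q M + weight q N)%N.
Proof. by rewrite /weight !mnmDE; ring. Qed.

(** A monomial [M] with [M ix <= q] has weight [q.+1 * deg M - M ix], so that
    the weight is a base-[q.+1] encoding of the pair that [drl_lt] compares. *)
Lemma weight_lt_drl q (M N : 'X_{1..2}) : (M ix <= q)%N -> (N ix <= q)%N ->
  (weight q M < weight q N)%N -> drl_lt M N.
Proof.
rewrite /weight /drl_lt.
move: (M ix) (M iy) (N ix) (N iy) => a b c d le_aq le_cq lt_w.
have [|] := ltnP (a + b) (c + d); first by [].
move=> le_deg /=.
have e1 : (a * q + b * q.+1 + a = (a + b) * q.+1)%N by ring.
have e2 : (c * q + d * q.+1 + c = (c + d) * q.+1)%N by ring.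
have [lt_deg|le_deg'] := ltnP (c + d) (a + b).
  have : ((c + d).+1 * q.+1 <= (a + b) * q.+1)%N by rewrite leq_mul2r lt_deg.
  by rewrite mulSn; lia.
have eq_deg : (a + b = c + d)%N by lia.
by rewrite eq_deg eqxx /=; rewrite eq_deg in e1; lia.
Qed.

Lemma weight_inj_reduced q (M N : 'X_{1..2}) : (M ix <= q)%N -> (N ix <= q)%N ->
  weight q M = weight q N -> M = N.
Proof.
rewrite /weight => le_aq le_cq; rewrite [M]xymon_eta [N]xymon_eta.
rewrite !xymon_ix !xymon_iy.
move: (M ix) (M iy) (N ix) (N iy) le_aq le_cq => a b c d le_aq le_cq eq_w.
have e1 : (a * q + b * q.+1 + a = (a + b) * q.+1)%N by ring.
have e2 : (c * q + d * q.+1 + c = (c + d) * q.+1)%N by ring.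
have eq_deg : (a + b = c + d)%N.
  case: (ltngtP (a + b) (c + d)) => // lt_deg.
    have := leq_mul lt_deg (leqnn q.+1); rewrite mulSn; lia.
  have := leq_mul lt_deg (leqnn q.+1); rewrite mulSn; lia.
rewrite eq_deg in e1.
have eq_ac : a = c by lia.
by rewrite eq_ac; congr xymon; lia.
Qed.

(** * Ideals containing the equation of the curve *)

Section IdealOverCurve.

Variables (F : finFieldType) (q : nat) (I : {mpoly F[2]} -> Prop).
Hypothesis idI : is_ideal I.

Lemma ideal0 : I 0. Proof. by case: idI. Qed.

Lemma idealD f g : I f -> I g -> I (f + g).
Proof. by case: idI => _ h _; apply: h. Qed.

Lemma idealM a f : I f -> I (a * f).
Proof. by case: idI => _ _ h; apply: h. Qed.

Lemma idealZ (c : F) f : I f -> I (c *: f).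
Proof. by rewrite -mul_mpolyC; apply: idealM. Qed.

Lemma idealB f g : I f -> I g -> I (f - g).
Proof. by move=> If Ig; rewrite -scaleN1r; apply/idealD/idealZ. Qed.

Lemma ideal_sum (T : Type) (r : seq T) (P : pred T) (f : T -> {mpoly F[2]}) :
  (forall t, P t -> I (f t)) -> I (\sum_(t <- r | P t) f t).
Proof. by move=> If; apply: (big_ind I) => //; [apply: ideal0|apply: idealD]. Qed.

(** In coordinates on the given basis of the quotient, the family becomes the
    rows of a [#|T| x d] matrix, and a vector of its row kernel is a relation
    modulo [I]. *)
Lemma indep_card_le_dim (d : nat) (T : finType) (e : T -> {mpoly F[2]}) :
  quot_dim I d ->
  (forall c : T -> F, I (\sum_t c t *: e t) -> forall t, c t = 0) ->
  (#|T| <= d)%N.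
Proof.
case=> b coordP indep.
have /fin_all_exists[C CP] : forall t, exists c : {ffun 'I_d -> F},
    I (e t - \sum_i c i *: b i).
  by move=> t; have [c [Ic _]] := coordP (e t); exists c.
pose M : 'M[F]_(#|T|, d) := \matrix_(k, i) C (enum_val k) i.
suff: row_free M by rewrite /row_free => /eqP <-; apply: rank_leq_col.
rewrite -kermx_eq0; apply/eqP/row_matrixP => k; rewrite row0.
set w := row k _.
have wM0 : w *m M = 0 by rewrite /w -row_mul mulmx_ker row0.
suff w0 t : w 0 (enum_rank t) = 0.
  by apply/rowP => j; rewrite -(enum_valK j) w0 mxE.
apply: (indep (fun t => w 0 (enum_rank t))) => {t}.
have -> : \sum_t w 0 (enum_rank t) *: e t =
    \sum_t w 0 (enum_rank t) *: (e t - \sum_i C t i *: b i).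
  under [RHS]eq_bigr do rewrite scalerBr.
  rewrite sumrB [X in _ - X](_ : _ = 0) ?subr0 //.
  under eq_bigr do rewrite scaler_sumr.
  rewrite exchange_big big1 //= => i _.
  under eq_bigr do rewrite scalerA.
  rewrite -scaler_suml [X in X *: _](_ : _ = 0) ?scale0r //.
  transitivity ((w *m M) 0 i); last by rewrite wM0 mxE.
  rewrite mxE.
  rewrite (reindex enum_rank) /=; last exact/onW_bij/enum_rank_bij.
  by apply: eq_bigr => t _; rewrite [M _ _]mxE enum_rankK.
by apply: ideal_sum => t _; apply: idealZ.
Qed.

(** * Reduction modulo the curve *)

Hypothesis q_gt1 : (1 < q)%N.
Hypothesis IH : I (hermitian_poly F q).

Lemma hermitian_rewrite u v :
  I ('X_[xymon (u + q.+1) v] - ('X_[xymon u (v + q)] + 'X_[xymon u v.+1])).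
Proof.
have := idealM 'X_[xymon u v] IH; congr I.
rewrite /hermitian_poly !mpolyXn !mulrBr -!mpolyXD.
rewrite /xymon.
rewrite opprD addrA; congr (_ - _ - _); congr 'X_[_].
- by apply/mnmP=> i; rewrite !mnmDE !mulmnE; ring.
- by apply/mnmP=> i; rewrite !mnmDE !mulmnE; ring.
- by apply/mnmP=> i; rewrite !mnmDE !mulmnE; ring.
Qed.

Definition weights_below s (f : {mpoly F[2]}) :=
  forall M, M \in msupp f -> (weight q M < s)%N.

Definition reduced_below s (f : {mpoly F[2]}) :=
  forall M, M \in msupp f -> (M ix <= q)%N && (weight q M < s)%N.

Lemma reduced_belowD s f g :
  reduced_below s f -> reduced_below s g -> reduced_below s (f + g).
Proof.
move=> rf rg M /msuppD_le; rewrite mem_cat.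
by case/orP; [apply: rf|apply: rg].
Qed.

Lemma reduced_belowZ s (c : F) f : reduced_below s f -> reduced_below s (c *: f).
Proof. by move=> rf M /msuppZ_le; apply: rf. Qed.

Lemma weights_belowD s f g :
  weights_below s f -> weights_below s g -> weights_below s (f + g).
Proof.
move=> rf rg M /msuppD_le; rewrite mem_cat.
by case/orP; [apply: rf|apply: rg].
Qed.

Lemma weights_belowZX s (c : F) M :
  (weight q M < s)%N -> weights_below s (c *: 'X_[M]).
Proof. by move=> lt_M N /msuppZ_le; rewrite msuppX inE => /eqP->. Qed.

Definition reducible_below s f := exists2 g, reduced_below s g & I (f - g).

(** Each use of [hermitian_rewrite] lowers the exponent of [x] by [q.+1] and
    replaces the monomial by one of equal weight and one of smaller weight. *)
Lemma reducible_belowX s M : (weight q M < s)%N -> reducible_below s 'X_[M].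
Proof.
rewrite [M]xymon_eta weight_xymon; move: (M iy); move: (M ix) => r.
elim/ltn_ind: r => r IHr v lt_s.
have [le_rq|lt_qr] := leqP r q.
  exists 'X_[xymon r v]; last by rewrite subrr; apply: ideal0.
  by move=> N; rewrite msuppX inE => /eqP->; rewrite weight_xymon xymon_ix le_rq.
have [k def_r] : exists k, r = (k + q.+1)%N by exists (r - q.+1)%N; lia.
rewrite {r}def_r in IHr lt_s lt_qr *.
have [|//|g1 g1P Ig1] := IHr k _ (v + q)%N; [lia| |].
  by apply: leq_ltn_trans lt_s; rewrite leq_eqVlt; apply/orP; left; apply/eqP; ring.
have [|//|g2 g2P Ig2] := IHr k _ v.+1; [lia| |].
  apply: leq_ltn_trans lt_s.
  by have := leq_pmulr q.+1 (ltnW q_gt1); lia.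
exists (g1 + g2); first exact: reduced_belowD.
have := idealD (hermitian_rewrite k v) (idealD Ig1 Ig2); congr I.
by rewrite opprD; ring.
Qed.

Lemma reducible_weights_below s f : weights_below s f -> reducible_below s f.
Proof.
move=> lt_f; rewrite [f]mpolyE big_seq.
apply: (big_ind (reducible_below s)).
- exists 0; first by move=> M; rewrite msupp0.
  by rewrite subrr; apply: ideal0.
- move=> f1 f2 [g1 r1 I1] [g2 r2 I2]; exists (g1 + g2).
    exact: reduced_belowD.
  by rewrite opprD addrACA; apply: idealD.
- move=> M /lt_f /reducible_belowX[g rg Ig]; exists (f@_M *: g).
    exact: reduced_belowZ.
  by rewrite -scalerBr; apply: idealZ.
Qed.

(** The hypothesis bounds weights, not positions in the order [drl_lt]: [h] may
    contain monomials that are [drl_lt]-larger than [x^u y^v].  They have an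
    exponent of [x] above [q], and reduction removes them. *)
Lemma lead_initial_ideal u v h : (u <= q)%N ->
  weights_below (weight q (xymon u v)) h -> I ('X_[xymon u v] + h) ->
  initial_ideal I 'X_[xymon u v].
Proof.
move=> le_uq /reducible_weights_below[g rg Ig] If J idJ sJ.
apply: sJ; exists ('X_[xymon u v] + g), (xymon u v); split=> //.
  have := idealB If Ig; congr I; ring.
have g0 : g@_(xymon u v) = 0.
  by apply/memN_msupp_eq0/negP => /rg; rewrite ltnn andbF.
split.
  by rewrite mcoeff_msupp mcoeffD mcoeffX eqxx g0 addr0 oner_neq0.
move=> N /msuppD_le; rewrite mem_cat msuppX inE.
case/orP => [/eqP->|/rg /andP[le_Nq lt_N] _]; first by rewrite eqxx.
by apply: (weight_lt_drl le_Nq _ lt_N); rewrite xymon_ix.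
Qed.

(** The second case for [M + N] is that of a monomial which is congruent to
    [x^u y^v + x^u y^(v-q+1)] and has the weight of [x^u y^v]. *)
Lemma footprint_lead_weight u v M N h (c : F) :
  footprint I (xymon u v) -> (u <= q)%N -> c != 0 ->
  (M + N)%MM = xymon u v \/
    (M + N)%MM = xymon (u + q.+1) (v - q) /\ (q <= v)%N ->
  weights_below (weight q M) h -> ~ I (c *: 'X_[M] + h).
Proof.
move=> fp le_uq c0 MN lt_h If; apply: fp.
pose h' := c^-1 *: (h * 'X_[N]).
have lt_h' : weights_below (weight q (M + N)) h'.
  move=> L /msuppZ_le; rewrite (perm_mem (msuppMX _ _)) => /mapP[L' /lt_h lt_L' ->].
  by rewrite !weightD; lia.
have If' : I ('X_[M + N] + h').
  have := idealZ c^-1 (idealM 'X_[N] If); congr I.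
  by rewrite mulrDr -scalerAr scalerDr scalerA mulVf // scale1r -mpolyXD addmC [_ * h]mulrC.
case: MN => [def_MN|[def_MN le_qv]]; rewrite def_MN in lt_h' If'.
  exact: lead_initial_ideal If'.
have eq_w : weight q (xymon (u + q.+1) (v - q)) = weight q (xymon u v).
  by rewrite !weight_xymon -[in RHS](subnK le_qv); ring.
apply: (@lead_initial_ideal _ _ ('X_[xymon u (v - q).+1] + h')) => //.
  apply: weights_belowD; last by rewrite -eq_w.
  rewrite -['X_[_]]scale1r; apply: weights_belowZX.
  by rewrite !weight_xymon ltn_add2l ltn_mul2r /=; lia.
have := idealB If' (hermitian_rewrite u (v - q)); rewrite subnK //; congr I; ring.
Qed.

(** * The order bound *)

(** The two summands count the monomials [x^a y^b], [a <= q], whose weight can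
    be completed to that of [x^u y^v]: for [a <= u] within [x^u y^v] itself, for
    [u < a <= q] within [x^(u+q+1) y^(v-q)].  It is the Feng-Rao order bound of
    the semigroup generated by [q] and [q.+1]. *)
Lemma footprint_card_le_dim u v d : (u <= q)%N ->
  footprint I (xymon u v) -> quot_dim I d ->
  (u.+1 * v.+1 + (q - u) * (v.+1 - q) <= d)%N.
Proof.
move=> le_uq fp dimI.
pose T := ('I_u.+1 * 'I_v.+1 + 'I_(q - u) * 'I_(v.+1 - q))%type.
pose e (t : T) : 'X_{1..2} := match t with
  | inl (a, b) => xymon a b
  | inr (a, b) => xymon (u.+1 + a) b end.
(* The cofactor brings the weight of [e t] up to that of [x^u y^v]. *)
pose cof (t : T) : 'X_{1..2} := match t with
  | inl (a, b) => xymon (u - a) (v - b)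
  | inr (a, b) => xymon (q - a) (v - q - b) end.
have e_red t : (e t ix <= q)%N.
  case: t => [] [[a lt_a] [b lt_b]] /=; rewrite xymon_ix; lia.
have e_inj : injective e.
  move=> t1 t2 eq_e.
  have := congr1 (fun M : 'X_{1..2} => M ix) eq_e.
  have := congr1 (fun M : 'X_{1..2} => M iy) eq_e.
  case: t1 t2 {eq_e} => [] [[a lt_a] [b lt_b]] [] [[a' lt_a'] [b' lt_b']] /=;
    rewrite !xymon_ix !xymon_iy => eb ea; try lia.
    by congr (inl (_, _)); apply: val_inj.
  by congr (inr (_, _)); apply: val_inj => //=; lia.
have e_cof t : (e t + cof t)%MM = xymon u v \/
    (e t + cof t)%MM = xymon (u + q.+1) (v - q) /\ (q <= v)%N.
  case: t => [] [[a lt_a] [b lt_b]] /=; rewrite xymonD; [left|right].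
    by congr xymon; lia.
  by split; [congr xymon|]; lia.
have -> : (u.+1 * v.+1 + (q - u) * (v.+1 - q) = #|{: T}|)%N.
  by rewrite card_sum !card_prod !card_ord.
apply: (indep_card_le_dim (e := fun t => 'X_[e t]) dimI) => c Ic t.
apply/eqP/negPn/negP => ct0.
case: (@arg_maxnP _ t (fun t => c t != 0) (fun t => weight q (e t)) ct0) => t0 c0 max_t0.
move: Ic; rewrite (bigD1 t0) //=.
apply: (footprint_lead_weight fp le_uq c0 (e_cof t0)).
apply: (big_ind (weights_below _)) => [M|f g|t1 ne_t]; first by rewrite msupp0.
  exact: weights_belowD.
have [->|c1] := eqVneq (c t1) 0; first by move=> M; rewrite scale0r msupp0.
apply: weights_belowZX; rewrite ltn_neqAle [X in _ && X](max_t0 _ c1) andbT.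
apply: contraNneq ne_t => eq_w; apply/eqP/e_inj.
exact: weight_inj_reduced eq_w.
Qed.

End IdealOverCurve.

(** A form of [nu(s) >= s + 1 - 2g] with [s = w(x^u y^v)] and [2g = q^2 - q].
    Equality holds if [v >= q]; otherwise the difference of the two sides
    is [(q - u) (q - 1 - v)]. *)
Lemma order_bound q u v : (u <= q)%N ->
  (u * q + v * q.+1 + q + 1 <= u.+1 * v.+1 + (q - u) * (v.+1 - q) + q ^ 2)%N.
Proof.
move=> le_uq; have [le_qv|lt_vq] := leqP q v.
  rewrite subSn //; have [k def_q] : exists k, q = (u + k)%N by exists (q - u)%N; lia.
  have [j ->] : exists j, v = (q + j)%N by exists (v - q)%N; lia.
  by rewrite def_q !addKn; lia.
have : 0 <= (q%:Z - u%:Z) * (q%:Z - v%:Z - 1) by apply: mulr_ge0; lia.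
by rewrite (_ : v.+1 - q = 0)%N; lia.
Qed.

Theorem theorem4p1 (p e q : nat) (hp : prime p) (he : (0 < e)%N)
    (hq : q = (p ^ e)%N)
    (F : finFieldType) (hF : #|F| = (q ^ 2)%N)
    (m : nat) (C : {vspace {ffun hpoint F q -> F^o}})
    (hC : is_hermitian_code m C)
    (hm : (q ^ 2 - q - 1 <= m)%N)
    (mt : nat) (hmt : is_tilde q m mt) (hmmt : m = mt)
    (u v kappa : nat) (hB : inB q (xymon u v))
    (hw : weight q (xymon u v) = (m + 1 + kappa)%N) (hkappa : (kappa <= q)%N)
    (D : divisor F q) (hD : footprint (div_ideal D) (xymon u v)) :
  delta q mt + kappa%:Z <= (div_deg D)%:Z
  /\ forall mu la : nat, (mu <= q)%N ->
     delta q m = mu%:Z * q%:Z + la%:Z * (q%:Z + 1) ->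
     [/\ (* (a) *)
         mu = 0%N -> kappa%:Z <= q%:Z - la%:Z ->
           delta q mt + kappa%:Z * (q%:Z + 1 - la%:Z - kappa%:Z)
             <= (div_deg D)%:Z,
         (* (b) *)
         mu = 0%N -> q%:Z - la%:Z + 1 <= kappa%:Z ->
           delta q mt + kappa%:Z <= (div_deg D)%:Z,
         (* (c) *)
         mu <> 0%N -> kappa%:Z <= mu%:Z - 1 ->
           delta q mt + kappa%:Z <= (div_deg D)%:Z,
         (* (d) *)
         mu <> 0%N -> mu%:Z <= kappa%:Z -> kappa%:Z <= q%:Z - la%:Z ->
           delta q mt
             + (kappa%:Z - mu%:Z) * (q%:Z - la%:Z - kappa%:Z) + kappa%:Z
             <= (div_deg D)%:Z
       & (* (e) *)
         mu <> 0%N -> q%:Z - la%:Z + 1 <= kappa%:Z ->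
           delta q mt + kappa%:Z <= (div_deg D)%:Z].
Proof.
have q_gt1 : (1 < q)%N.
  by rewrite hq -(exp1n e) ltn_exp2r ?prime_gt1.
have le_uq : (u <= q)%N.
  move: hB; rewrite /inB xymon_ix xymon_iy.
  by case/orP => [/andP[]//|/and3P[/eqP->]].
have := footprint_card_le_dim (div_ideal_ideal D) q_gt1 (div_ideal_H D)
          le_uq hD (div_degP D).
move: (div_deg D) => d le_d.
rewrite weight_xymon in hw; subst mt.
have general : delta q m + kappa%:Z <= d%:Z.
  by have := order_bound v le_uq; rewrite /delta; lia.
split=> // mu la le_muq def_m.
have rectangle : (mu <= kappa)%N ->
    delta q m + (kappa%:Z - mu%:Z) * (q%:Z - la%:Z - kappa%:Z) + kappa%:Z
      <= d%:Z.
  move=> le_mk.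
  have eq_s : (u * q + v * q.+1 + q + 1 = mu * q + la * q.+1 + q * q + kappa)%N.
    by move: def_m; rewrite /delta; lia.
  have [def_u def_v] : (u + kappa = q + mu /\ v.+1 = la + kappa)%N.
    (* Both [u] and [q + mu - kappa] lie between 0 and [q], so this equation
       determines quotient and remainder modulo [q.+1]. *)
    have eq_S : ((u + v).+1 * q.+1 + (q + mu)
                 = (q + mu + la) * q.+1 + (u + kappa))%N by lia.
    suff eq_deg : ((u + v).+1 = q + mu + la)%N by rewrite eq_deg in eq_S; lia.
    case: (ltngtP (u + v).+1 (q + mu + la)%N) => // lt_deg;
      have := leq_mul lt_deg (leqnn q.+1); rewrite mulSn; lia.
  have count_uv : (u.+1 * v.+1)%N%:Z =
      (q%:Z + mu%:Z - kappa%:Z + 1) * (la%:Z + kappa%:Z).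
    by rewrite PoszM; congr (_ * _); lia.
  have := leq_trans (leq_addr _ _) le_d; rewrite -lez_nat count_uv def_m.
  by apply: le_trans; rewrite le_eqVlt; apply/orP; left; apply/eqP; ring.
split=> //.
- by move=> mu0 _; move: rectangle; rewrite mu0 => /(_ isT); congr (_ <= _); ring.
- by move=> _ le_mk _; apply: rectangle; lia.
Qed.
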